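(* Let $\beta,b\in\mathbb{N}^m$ and $A=[A_1|\cdots|A_n]\in\mathbb{N}^{m\times n}$ be such that $\beta\geq b$ and $\beta\geq A_k$ for all $1\leq k\leq n$. Set $p:=\sum_{k=1}^n\prod_{j=1}^m(1+\beta_j-A_{j;k})$. The following three statements are equivalent: (a) The linear system $Ax=b$ has a solution $x\in\mathbb{N}^n$. (b) There is a real nonnegative vector $\mathbf{y}=(y[k,u])\in\mathbb{R}^p$ such that $$b^z-0^z=\sum_{k=1}^n\;\sum_{u\in\mathbb{N}^m,\,u\leq\beta-A_k}y[k,u]\big((u+A_k)^z-u^z\big)$$ for every $z\in\mathbb{N}^m$ with $0\leq z\leq\beta$. (c) There is a real nonnegative vector $\mathbf{y}=(y[k,u])\in\mathbb{R}^p$ such that $$z^b-1=\sum_{k=1}^n\;\sum_{u\in\mathbb{N}^m,\,u\leq\beta-A_k}y[k,u]\big(z^{u+A_k}-z^u\big)$$ for every $z\in\mathbb{N}^m$ with $0\leq z\leq\beta$.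
   Context: $\mathbb{N}=\{0,1,2,\dots\}$. $A_k=(A_{1;k},\dots,A_{m;k})'$ is the $k$-th column of $A$, and $A_{j;k}$ is its entry in row $j$, column $k$. Inequalities between vectors are entrywise. For $w,z\in\mathbb{N}^m$, $w^z:=w_1^{z_1}w_2^{z_2}\cdots w_m^{z_m}$ with the convention $0^0=1$; in particular, for the zero vector $0\in\mathbb{N}^m$, $0^z=1$ if $z=0$ and $0^z=0$ if $z\neq0$. The entries of $\mathbf{y}\in\mathbb{R}^p$ are indexed by the pairs $(k,u)$ with $1\leq k\leq n$, $u\in\mathbb{N}^m$, $u\leq\beta-A_k$ (there are exactly $p$ such pairs). *)

(* Defs.v *)
From mathcomp Require Import all_boot all_order all_algebra reals.

Set Implicit Arguments.
Unset Strict Implicit.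
Unset Printing Implicit Defensive.

Import GRing.Theory.
Local Open Scope ring_scope.

(* Vectors of N^m are columns over the semiring nat, so that [A *m x], [u + v]
   and [0] are the usual operations. *)

Definition vle (m : nat) (u v : 'cV[nat]_m) : Prop :=
  forall j : 'I_m, (u j ord0 <= v j ord0)%N.

(* [expn] satisfies [0 ^ 0 = 1]. *)
Definition vpow (m : nat) (w z : 'cV[nat]_m) : nat :=
  (\prod_(j < m) w j ord0 ^ z j ord0)%N.

(* beta - A_k; the truncated subtraction is exact as soon as A_k <= beta. *)
Definition vgap (m n : nat) (beta : 'cV[nat]_m) (A : 'M[nat]_(m, n))
    (k : 'I_n) : 'cV[nat]_m :=
  \col_j (beta j ord0 - A j k)%N.

(* The u in N^m with u <= v, as a finite type. *)
Definition box (m : nat) (v : 'cV[nat]_m) : finType :=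
  {dffun forall j : 'I_m, 'I_(v j ord0).+1}.

Definition box_val (m : nat) (v : 'cV[nat]_m) (u : box v) : 'cV[nat]_m :=
  \col_j (u j : nat).

(* The pairs (k, u) with u <= beta - A_k. *)
Definition pair_idx (m n : nat) (beta : 'cV[nat]_m) (A : 'M[nat]_(m, n)) :
    finType :=
  {k : 'I_n & box (vgap beta A k)}.

Definition mk_idx (m n : nat) (beta : 'cV[nat]_m) (A : 'M[nat]_(m, n))
    (k : 'I_n) (u : box (vgap beta A k)) : pair_idx beta A :=
  existT (fun k => box (vgap beta A k) : Type) k u.

Lemma box_val_inj (m : nat) (v : 'cV[nat]_m) : injective (@box_val m v).
Proof.
move=> u u' /colP e; apply/ffunP => j; apply/val_inj.
by have := e j; rewrite !mxE.
Qed.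

Lemma box_valP (m : nat) (v w : 'cV[nat]_m) :
  vle w v <-> exists u : box v, box_val u = w.
Proof.
split=> [le_wv | [u <-] j]; last by rewrite mxE -ltnS.
exists [ffun j : 'I_m => (inord (w j ord0) : 'I_(v j ord0).+1)].
by apply/colP => j; rewrite mxE ffunE inordK // ltnS.
Qed.

(* {ffun pair_idx beta A -> R} is R^p with p as below. *)
Lemma card_pair_idx (m n : nat) (beta : 'cV[nat]_m) (A : 'M[nat]_(m, n)) :
  (forall k : 'I_n, vle (col k A) beta) ->
  #|pair_idx beta A| = (\sum_(k < n) \prod_(j < m) (1 + beta j ord0 - A j k))%N.
Proof.
move=> leA; rewrite card_tagged sumnE big_map big_enum /=.
apply: eq_bigr => k _; rewrite card_dep_ffun foldrE big_map big_enum /=.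
apply: eq_bigr => j _; rewrite card_ord mxE addnC addn1 subSn //.
by have := leA k j; rewrite mxE.
Qed.

(* Main.v *)
(* Both systems say that the functional
     g |-> g b - g 0 - \sum_(k, u) y[k,u] (g (u + A_k) - g u)
   kills every function w |-> w^z (resp. w |-> z^w) with z <= beta. By
   invertibility of (tensor products of) Vandermonde matrices, either family
   spans all functions on the box [0, beta], so the functional kills every g
   there: y is a unit flow from 0 to b along the arcs u -> u + A_k. Testing it
   on the indicator function of {A x | x in N^n}, which contains 0 and does not
   decrease along arcs, shows that b lies in this set. Conversely, a solution x
   yields a lattice path from 0 to b, whose arc multiplicities are such a y. *)

Require Import Defs.
From mathcomp Require Import all_boot all_order all_algebra reals.
From mathcomp Require Import boolp.

Import Order.TTheory GRing.Theory Num.Theory.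
Local Open Scope ring_scope.

Lemma addcolE m (u v : 'cV[nat]_m) j :
  (u + v) j ord0 = (u j ord0 + v j ord0)%N.
Proof. by rewrite mxE. Qed.

Section Flow.
Context {R : numDomainType} {m n : nat}.
Variables (beta : 'cV[nat]_m) (A : 'M[nat]_(m, n)).
Implicit Types (y : {ffun pair_idx beta A -> R}) (g : 'cV[nat]_m -> R).

Definition flow_to (b : 'cV[nat]_m) y g : Prop :=
  g b - g 0 = \sum_(k < n) \sum_(u : box (vgap beta A k))
                y (mk_idx u) * (g (box_val u + col k A) - g (box_val u)).

Lemma flow_to_sum b y (I : finType) (P : pred I) (c : I -> R)
    (g : I -> 'cV[nat]_m -> R) :
  (forall i, P i -> flow_to b y (g i)) ->
  flow_to b y (fun w => \sum_(i | P i) c i * g i w).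
Proof.
move=> gP; rewrite /flow_to -sumrB.
under eq_bigr => i Pi do rewrite -mulrBr (gP i Pi) mulr_sumr.
rewrite exchange_big; apply: eq_bigr => k _.
under eq_bigr => i _ do rewrite mulr_sumr.
rewrite exchange_big; apply: eq_bigr => u _.
rewrite -sumrB mulr_sumr; apply: eq_bigr => i _.
by rewrite -mulrBr mulrCA.
Qed.

Lemma solution_of_flow b y : (forall i, 0 <= y i) ->
  (forall g, flow_to b y g) -> exists x : 'cV[nat]_n, A *m x = b.
Proof.
move=> y_ge0 /(_ (fun w => `[< exists x, A *m x = w >]%:R)) flow_y.
have reach0 : exists x : 'cV[nat]_n, A *m x = 0 by exists 0; rewrite mulmx0.
(* Every arc contributes a nonnegative term, whereas an unreachable [b] would make the left-hand
   side -1. *)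
have : 0 <= `[< exists x, A *m x = b >]%:R - 1 :> R.
  move: flow_y; rewrite /flow_to (asboolT reach0) => ->.
  apply: sumr_ge0 => k _; apply: sumr_ge0 => u _.
  apply: mulr_ge0 => //; rewrite subr_ge0 ler_nat.
  case: (asboolP (exists x, _ = box_val u)) => // -[x xu].
  rewrite asboolT //; exists (x + delta_mx k ord0).
  by rewrite mulmxDr xu colE.
by case: asboolP => // _; rewrite sub0r oppr_ge0 ler10.
Qed.

(** Induction on the sum of the entries of [x], the length of the path: lowering a positive entry by
    one removes the last arc, from [A *m x'] to [A *m x]. *)
Lemma flow_of_solution (x : 'cV[nat]_n) : vle (A *m x) beta ->
  exists y, (forall i, 0 <= y i) /\ forall g, flow_to (A *m x) y g.
Proof.
have [s] := ubnP (\sum_k x k ord0)%N.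
elim: s x => // s IHs x lt_x le_x.
have [/existsP[k xk_gt0] | /existsPn x0] := boolP [exists k, 0 < x k ord0]%N.
  pose x' : 'cV[nat]_n := \col_i (x i ord0 - (i == k))%N.
  have def_x : x = x' + delta_mx k ord0.
    apply/colP => i; rewrite addcolE !mxE eqxx andbT.
    case: eqP => [-> | _]; first by rewrite subnK.
    by rewrite subn0 addn0.
  have def_Ax : A *m x = A *m x' + col k A by rewrite def_x mulmxDr -colE.
  (* This makes [A *m x'] the start of an arc of the index set. *)
  have le_x' : vle (A *m x') (vgap beta A k).
    move=> j; have := le_x j.
    rewrite def_Ax addcolE [vgap _ _ _ _ _]mxE [col k A _ _]mxE addnC => le_j.
    by rewrite leq_subRL // (leq_trans _ le_j) // leq_addr.
  have [||y' [y'_ge0 flow_y']] := IHs x'.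
  - rewrite (leq_trans _ (ltnSE lt_x)) // (bigD1 k) // [X in (_ < X)%N](bigD1 k) //=.
    rewrite mxE eqxx subn1 -addSn prednK // leq_add2l.
    by apply: leq_sum => i _; rewrite mxE leq_subr.
  - by move=> j; rewrite (leq_trans (le_x' j)) // mxE leq_subr.
  have /box_valP[u0 def_u0] := le_x'.
  (* One more unit along that arc: its increment of [g] telescopes with [g (A *m x') - g 0]. *)
  exists [ffun i => y' i + (i == mk_idx u0)%:R].
  split=> [i|g]; first by rewrite ffunE addr_ge0.
  rewrite /flow_to.
  under eq_bigr => k' _ do under eq_bigr => u _ do rewrite ffunE mulrDl.
  under eq_bigr => k' _ do rewrite big_split /=.
  rewrite big_split -flow_y' /= def_Ax.
  (* As a single sum over dependent pairs, only the term at [mk_idx u0] survives. *)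
  rewrite (sig_big_dep _ _ (fun k' u => (mk_idx u == mk_idx u0)%:R * _)) /=.
  rewrite (bigD1 (mk_idx u0)) //= eqxx mul1r big1 ?addr0.
    by rewrite def_u0 addrC subrKA.
  by case=> k' u /= /negPf neq_u; rewrite /mk_idx /= neq_u mul0r.
exists 0; split=> [i|g]; first by rewrite ffunE.
have -> : x = 0.
  by apply/colP => i; rewrite mxE; apply/eqP; rewrite -leqn0 leqNgt x0.
rewrite /flow_to mulmx0 subrr big1 // => k _; rewrite big1 // => u _.
by rewrite ffunE mul0r.
Qed.

Hypothesis le_A_beta : forall k : 'I_n, vle (col k A) beta.

Lemma box_vgapP k (u : box (vgap beta A k)) :
  vle (box_val u) beta /\ vle (box_val u + col k A) beta.
Proof.
have le_u j : (box_val u j ord0 + col k A j ord0 <= beta j ord0)%N.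
  rewrite addnC -leq_subRL; last exact: le_A_beta.
  have : vle (box_val u) (vgap beta A k) by apply/box_valP; exists u.
  move/(_ j).
  by rewrite [X in (_ <= X)%N -> _]mxE [col k A j _]mxE.
split=> j; last by rewrite addcolE.
by rewrite (leq_trans _ (le_u j)) ?leq_addr.
Qed.

(** The points 0, [b] and both ends of every arc lie in the box, and [g] is evaluated nowhere
    else. *)
Lemma eq_flow_to b y g g' : vle b beta ->
  (forall w, vle w beta -> g w = g' w) -> flow_to b y g -> flow_to b y g'.
Proof.
move=> le_b eqg; have le_0 : vle 0 beta by move=> j; rewrite mxE.
rewrite /flow_to !eqg // => ->; apply: eq_bigr => k _; apply: eq_bigr => u _.
by have [? ?] := box_vgapP k u; rewrite !eqg.
Qed.

End Flow.

Section Kernel.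
Context {R : numFieldType} {m : nat}.

(** Spanning condition in one variable, asked for every [N] because coordinate [j] of the box uses
    [N = beta j ord0]. *)
Definition separating (f : nat -> nat -> R) : Prop :=
  forall N w0 : nat, (w0 <= N)%N -> exists c : nat -> R,
    forall w, (w <= N)%N -> \sum_(t < N.+1) c t * f w t = (w == w0)%:R.

(** The Vandermonde nodes 0, ..., [N] stay distinct in [R], which has characteristic 0. *)
Lemma expn_matrix_unit N :
  (\matrix_(i < N.+1, t < N.+1) (t ^ i)%:R : 'M[R]_N.+1) \in unitmx.
Proof.
rewrite (_ : \matrix_(i, t) _ = Vandermonde N.+1 (\row_(t < N.+1) t%:R)).
  rewrite unitmxE det_Vandermonde unitfE.
  apply/prodf_neq0 => i _; apply/prodf_neq0 => j lt_ij.
  by rewrite !mxE subr_eq0 eqr_nat gtn_eqF.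
by apply/matrixP => i t; rewrite !mxE natrX.
Qed.

Lemma separating_expn : separating (fun w t => (w ^ t)%:R).
Proof.
move=> N w0 le_w0; set V := \matrix_(i < N.+1, t < N.+1) (t ^ i)%:R : 'M[R]_N.+1.
(* Since [w ^ t] is entry (t, w) of [V], row [w0] of the inverse works. *)
exists (fun t => invmx V (inord w0) (inord t)) => w le_w.
have /matrixP/(_ (inord w0) (inord w)) := mulVmx (expn_matrix_unit N).
rewrite !mxE -val_eqE /= !inordK // eq_sym => <-.
by apply: eq_bigr => t _; rewrite !mxE inord_val inordK.
Qed.

Lemma separating_expn_tr : separating (fun w t => (t ^ w)%:R).
Proof.
move=> N w0 le_w0; set V := \matrix_(i < N.+1, t < N.+1) (t ^ i)%:R : 'M[R]_N.+1.
(* Since [t ^ w] is entry (w, t) of [V], column [w0] of the inverse works. *)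
exists (fun t => invmx V (inord t) (inord w0)) => w le_w.
have /matrixP/(_ (inord w) (inord w0)) := mulmxV (expn_matrix_unit N).
rewrite !mxE -val_eqE /= !inordK // => <-.
by apply: eq_bigr => t _; rewrite !mxE inord_val inordK // mulrC.
Qed.

Lemma flow_of_kernel (n : nat) (beta b : 'cV[nat]_m) (A : 'M[nat]_(m, n))
    (y : {ffun pair_idx beta A -> R}) (f : nat -> nat -> R) :
  vle b beta -> (forall k, vle (col k A) beta) -> separating f ->
  (forall z, vle z beta ->
     flow_to beta A b y (fun w => \prod_j f (w j ord0) (z j ord0))) ->
  forall g, flow_to beta A b y g.
Proof.
move=> le_b le_A sep_f flow_f g.
(* On the box, [g] is the combination of point indicators with coefficients [g (box_val w0)]. *)
suff flow_delta (w0 : box beta) :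
    flow_to beta A b y (fun w => (w == box_val w0)%:R).
  have := flow_to_sum _ _ _ _ _ predT (fun w0 => g (box_val w0)) _
    (fun w0 _ => flow_delta w0).
  apply: eq_flow_to => // w /box_valP[{}w0 <-].
  rewrite (bigD1 w0) //= eqxx mulr1 big1 ?addr0 // => w1 neq_w.
  by rewrite (inj_eq (@box_val_inj _ _)) eq_sym (negPf neq_w) mulr0.
have /fin_all_exists[c cP] j := sep_f _ _ (ltnSE (ltn_ord (w0 j))).
(* Distributivity needs one index type for all coordinates: ['I_N] covers every range up to
   [beta j ord0], and [in_box] cuts it back. *)
pose N := (\max_j beta j ord0).+1.
pose zcol (z : {ffun 'I_m -> 'I_N}) : 'cV[nat]_m := \col_j (z j : nat).
pose in_box (j : 'I_m) (t : 'I_N) := (t < (beta j ord0).+1)%N.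
have flow_z z : z \in family in_box ->
    flow_to beta A b y (fun w => \prod_j f (w j ord0) (zcol z j ord0)).
  by move=> /familyP le_z; apply: flow_f => j; rewrite mxE -ltnS; apply: le_z.
have := flow_to_sum _ _ _ _ _ (fun z => z \in family in_box)
  (fun z => \prod_j c j (z j)) _ flow_z.
apply: eq_flow_to => // w le_w.
under eq_bigr => z _ do rewrite -big_split /=.
under eq_bigr => z _ do under eq_bigr => j _ do rewrite mxE.
(* The sum over [z] factors into one-variable sums, each the indicator of [w0 j]. *)
rewrite -(bigA_distr_big_dep _ (fun j (t : 'I_N) => c j t * f (w j ord0) t)) /=.
transitivity (\prod_j (w j ord0 == w0 j)%:R : R).
  apply: eq_bigr => j _; rewrite -(cP _ _ (le_w j)).
  rewrite (big_ord_widen N (fun t => c j t * f (w j ord0) t)) //.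
  by rewrite ltnS; apply: (leq_bigmax (F := fun j => beta j ord0)).
case: eqP => [-> | neq_w]; first by rewrite big1 // => j _; rewrite mxE eqxx.
have [j neq_j] : exists j, w j ord0 != w0 j.
  apply/existsP; apply: contra_notT neq_w => /existsPn eq_w.
  by apply/colP => j; rewrite mxE; apply/eqP; have := eq_w j; rewrite negbK.
by rewrite (bigD1 j) //= (negPf neq_j) mul0r.
Qed.

End Kernel.

Theorem theorem7 (R : realType) (m n : nat) (beta b : 'cV[nat]_m)
    (A : 'M[nat]_(m, n))
    (le_b_beta : vle b beta)
    (le_A_beta : forall k : 'I_n, vle (col k A) beta) :
  [<-> exists x : 'cV[nat]_n, A *m x = b;
       exists y : {ffun pair_idx beta A -> R},
         (forall i, 0 <= y i) /\
         (forall z : 'cV[nat]_m, vle z beta ->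
            (vpow b z)%:R - (vpow 0 z)%:R =
            \sum_(k < n) \sum_(u : box (vgap beta A k))
              y (mk_idx u) * ((vpow (box_val u + col k A) z)%:R
                              - (vpow (box_val u) z)%:R));
       exists y : {ffun pair_idx beta A -> R},
         (forall i, 0 <= y i) /\
         (forall z : 'cV[nat]_m, vle z beta ->
            (vpow z b)%:R - 1 =
            \sum_(k < n) \sum_(u : box (vgap beta A k))
              y (mk_idx u) * ((vpow z (box_val u + col k A))%:R
                              - (vpow z (box_val u))%:R))].
Proof.
have sol_flow (f : nat -> nat -> R) (y : {ffun pair_idx beta A -> R}) :
    separating f -> (forall i, 0 <= y i) ->
    (forall z, vle z beta ->
       flow_to beta A b y (fun w => \prod_j f (w j ord0) (z j ord0))) ->
    exists x : 'cV[nat]_n, A *m x = b.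
  move=> sep_f y_ge0 flow_y; apply: solution_of_flow y_ge0 _.
  exact: flow_of_kernel flow_y.
have flow_sol : (exists x : 'cV[nat]_n, A *m x = b) ->
    exists y : {ffun pair_idx beta A -> R},
      (forall i, 0 <= y i) /\ forall g, flow_to beta A b y g.
  by case=> x xb; rewrite -xb; apply: flow_of_solution; rewrite xb.
have vpowE w z : (vpow w z)%:R = \prod_j (w j ord0 ^ z j ord0)%:R :> R.
  by rewrite /vpow -natr_prod.
have vpow0 z : vpow z 0 = 1%N by rewrite /vpow big1 // => j _; rewrite mxE.
tfae.
- move=> /flow_sol[y [y_ge0 flow_y]]; exists y; split=> // z _.
  exact: (flow_y (fun w => (vpow w z)%:R)).
(* The way to (c) leads through a solution of (a), whose flow [y'] satisfies the identity for every
   [g]; the 1 in (c) is [vpow z 0]. *)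
- move=> [y [y_ge0 yP]].
  have /flow_sol[y' [y'_ge0 flow_y']] : exists x : 'cV[nat]_n, A *m x = b.
    apply: (sol_flow _ y separating_expn) => // z /yP; rewrite /flow_to -!vpowE => ->.
    by apply: eq_bigr => k _; apply: eq_bigr => u _; rewrite -!vpowE.
  exists y'; split=> // z _.
  by have := flow_y' (fun w => (vpow z w)%:R); rewrite /flow_to vpow0.
- move=> [y [y_ge0 yP]].
  apply: (sol_flow _ y separating_expn_tr) => // z /yP.
  rewrite /flow_to -!vpowE vpow0 => ->.
  by apply: eq_bigr => k _; apply: eq_bigr => u _; rewrite -!vpowE.
Qed.
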